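(* Let $\alpha>0$. There is a constant $C>0$, depending only on $\alpha$, such that for each $L>0$, each subset $E\subset[0,L]$ with $c_{h_\alpha}(E)>0$ and each $\lambda>0$, $$\sup_{x\in[0,L]}|\phi(x)|\le e^{C(L+1)^2\sqrt\lambda}\exp\Big\{\frac{C(L+1)^2\lambda(\log(\lambda+e))^{-\frac{2\alpha}3}}{c^2_{h_\alpha}(E)}\Big\}\sup_{x\in E}|\phi(x)|\qquad\text{for all }\phi\in\mathcal E_\lambda .$$
   Context: For $L>0$ put $\lambda_k=(k\pi/L)^2$ and $\phi_k(x)=\sin\frac{k\pi x}L$, $x\in[0,L]$, $k=1,2,\dots$ (Dirichlet eigenvalues and eigenfunctions of $-\partial_x^2$ on $(0,L)$), and $\mathcal E_\lambda=\mathrm{Span}\{\phi_k:\lambda_k\le\lambda\}$. $c^2_{h_\alpha}(E)=(c_{h_\alpha}(E))^2$. A gauge function is a strictly increasing continuous $f:(0,\infty)\to[0,\infty)$ with $\lim_{t\to0^+}f(t)=0$. For a gauge function $f$, the $f$-Hausdorff content of $E\subset\mathbb R$ is $c_f(E)=\inf\{\sum_{j\ge1} f(d(B_j)):E\subset\bigcup_{j\ge1} B_j\}$, where the $B_j$ are open balls (intervals) with diameter $d(B_j)$. $h_\alpha(t)=(\log\frac1t)^{-1/2}(\log\log\frac1t)^{-\alpha}$ for $0<t\le e^{-3}$, understood as a gauge function on $(0,\infty)$ via a fixed extension with $h_\alpha(t)\sim1$ as $t\to+\infty$. *)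

(* Defs.v *)
From HB Require Import structures.
From mathcomp Require Import all_boot all_order all_algebra.
From mathcomp Require Import all_classical all_reals all_analysis.

Set Implicit Arguments.
Unset Strict Implicit.
Unset Printing Implicit Defensive.

Import Order.TTheory GRing.Theory Num.Theory.
Import numFieldNormedType.Exports.

Local Open Scope classical_set_scope.
Local Open Scope ring_scope.

(* Only the values of f on (0, +oo) are constrained. *)
Definition gauge_function (R : realType) (f : R -> R) : Prop :=
  [/\ {in `]0, +oo[ &, {homo f : s t / s < t}},
      {in `]0, +oo[, continuous f},
      {in `]0, +oo[, forall t, 0 <= f t} &
      f t @[t --> 0^'+] --> (0 : R)].

(* The balls are nondegenerate, so that f is only evaluated on (0, +oo); since
   f tends to 0 at 0+, finite covers are recovered by padding with arbitrarily
   small balls. *)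
Definition hausdorff_content (R : realType) (f : R -> R) (E : set R) : \bar R :=
  ereal_inf [set s : \bar R | exists (x r : nat -> R),
    [/\ (forall j, 0 < r j),
        E `<=` \bigcup_j ball (x j) (r j) &
        s = (\sum_(0 <= j <oo) (f (2 * r j))%:E)%E]].

(* h is a gauge function extending the formula
   (log 1/t)^(-1/2) (log log 1/t)^(-alpha) on (0, e^-3], with h(t) ~ 1 at +oo. *)
Definition is_h_alpha (R : realType) (alpha : R) (h : R -> R) : Prop :=
  [/\ gauge_function h,
      (forall t, 0 < t -> t <= expR (- 3) ->
         h t = (ln t^-1) `^ (- (1 / 2)) * (ln (ln t^-1)) `^ (- alpha)) &
      h t @[t --> +oo] --> (1 : R)].

Definition dirichlet_eigenvalue (R : realType) (L : R) (k : nat) : R :=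
  (k%:R * pi / L) ^+ 2.

Definition dirichlet_eigenfunction (R : realType) (L : R) (k : nat) : R -> R :=
  fun x => sin (k%:R * pi * x / L).

Definition linear_span (R : realType) (A : set (R -> R)) : set (R -> R) :=
  [set phi | exists (n : nat) (c : 'I_n -> R) (v : 'I_n -> R -> R),
    (forall i, A (v i)) /\ phi = (fun x => \sum_(i < n) c i * v i x)].

Definition spectral_space (R : realType) (L lambda : R) : set (R -> R) :=
  linear_span (dirichlet_eigenfunction L @`
    [set k : nat | (1 <= k)%N /\ dirichlet_eigenvalue L k <= lambda]).

Definition sup_abs (R : realType) (A : set R) (phi : R -> R) : R :=
  sup [set `|phi x| | x in A].

(* Main.v *)
(* Let n = 2N+1 with N of order L sqrt(lambda).  The square of an element of the
   spectral space is a polynomial of degree at most 2N in cos(pi x / L), hence is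
   recovered by Lagrange interpolation from n nodes of E, and
   |cos(pi a / L) - cos(pi b / L)| >= ((a - b) / L)^2 / 2 controls the basis
   polynomials by the products of 2L / |x_i - x_j| over j <> i.  In dimension one
   the function t |-> c_h(E /\ (-oo, t]) is continuous with increments at most
   h(2d) over intervals of length d, so it plays the role of a Frostman measure:
   equidistributing the nodes for it gives h(2|x_i - x_j|) >= c |i - j| / (2n).
   For h = h_alpha this means log(1 / |x_i - x_j|) is at most
   (n / (c |i - j|))^2 (log lambda)^(-2 alpha) up to constants and to a negligible
   power of lambda, and these bounds are summable in j. *)
Require Import Defs.
From mathcomp Require Import all_boot all_order all_algebra.
From mathcomp Require Import all_classical all_reals all_analysis.
From mathcomp Require Import ring lra.
Import Order.TTheory GRing.Theory Num.Theory.
Import numFieldNormedType.Exports.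
Local Open Scope classical_set_scope.
Local Open Scope ring_scope.

Set Implicit Arguments.
Unset Strict Implicit.
Unset Printing Implicit Defensive.

(** * Gauge functions and Hausdorff content on the line *)

Lemma gauge_homo (R : realType) (f : R -> R) (s t : R) :
  gauge_function f -> 0 < s -> s <= t -> f s <= f t.
Proof.
move=> [fm _ _ _] s0; rewrite le_eqVlt => /predU1P[->//|st].
by apply/ltW/fm => //; rewrite in_itv/= andbT// (lt_trans s0).
Qed.

Lemma gauge_ge0 (R : realType) (f : R -> R) (t : R) :
  gauge_function f -> 0 < t -> 0 <= f t.
Proof. by move=> [_ _ f0 _] t0; apply: f0; rewrite in_itv/= t0. Qed.

Lemma gauge_small (R : realType) (f : R -> R) (e : R) :
  gauge_function f -> 0 < e ->
  exists2 r, 0 < r & forall t, 0 < t -> t <= r -> f t <= e.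
Proof.
move=> gf e0; have [_ _ _ f0] := gf.
have /cvgrPdist_le/(_ _ e0) := f0.
rewrite near_withinE => /nbhs_ballP[d /= d0 db].
exists (d / 2); first by rewrite divr_gt0.
move=> t t0 td.
have : `|0 - f t| <= e.
  apply: db => //; rewrite /ball/= sub0r normrN gtr0_norm//.
  by rewrite (le_lt_trans td)// ltr_pdivrMr// ltr_pMr// ltr1n.
by rewrite sub0r normrN; exact: le_trans (ler_norm _).
Qed.

Lemma hausdorff_content_ge0 (R : realType) (f : R -> R) (A : set R) :
  gauge_function f -> (0 <= hausdorff_content f A)%E.
Proof.
move=> gf; apply: le_ereal_inf_tmp => _ [x [r [r0 _ ->]]].
by apply: nneseries_ge0 => j _ _; rewrite lee_fin (gauge_ge0 gf)// mulr_gt0.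
Qed.

Lemma le_hausdorff_content (R : realType) (f : R -> R) (A B : set R) :
  A `<=` B -> (hausdorff_content f A <= hausdorff_content f B)%E.
Proof.
move=> AB; apply: ereal_inf_le_tmp => _ [x [r [r0 Bxr ->]]].
by exists x, r; split => //; exact: subset_trans Bxr.
Qed.

(** Even the empty set is covered by infinitely many nondegenerate balls, so their gauge values are
    made at most [e / 2 ^ j.+1], which sum to at most [e]. *)
Lemma hausdorff_content_set0 (R : realType) (f : R -> R) :
  gauge_function f -> hausdorff_content f set0 = 0%E.
Proof.
move=> gf; apply/eqP; rewrite eq_le hausdorff_content_ge0// andbT.
apply/lee_addgt0Pr => e e0; rewrite add0e.
have /choice[r rP] : forall j : nat, exists r : R,
    0 < r /\ f (2 * r) <= e / (2 ^ j.+1)%:R.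
  move=> j; have [|r r0 fr] := @gauge_small _ _ (e / (2 ^ j.+1)%:R) gf.
    by rewrite divr_gt0// ltr0n expn_gt0.
  exists (r / 2); split; first by rewrite divr_gt0.
  by apply: fr; rewrite mulrC divfK.
apply: (@le_trans _ _ (\sum_(0 <= j <oo) (f (2 * r j))%:E)%E).
  by apply: ereal_inf_lbound; exists (fun=> 0), r; split => // j; case: (rP j).
apply: le_trans (epsilon_trick0 xpredT (ltW e0)).
apply: lee_nneseries => [j _|j _]; rewrite lee_fin; last by case: (rP j).
by rewrite (gauge_ge0 gf)// mulr_gt0//; case: (rP j).
Qed.

Lemma hausdorff_content_setU_ball (R : realType) (f : R -> R) (A : set R)
    (x r : R) : gauge_function f -> 0 < r ->
  (hausdorff_content f (A `|` ball x r)
   <= hausdorff_content f A + (f (2 * r))%:E)%E.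
Proof.
move=> gf r0; rewrite -leeBlDr//; apply: le_ereal_inf_tmp => _ [y [s [s0 Ays ->]]].
rewrite leeBlDr//.
pose y' j := if j is k.+1 then y k else x.
pose s' j := if j is k.+1 then s k else r.
have s'0 j : 0 < s' j by case: j.
apply: (@le_trans _ _ (\sum_(0 <= j <oo) (f (2 * s' j))%:E)%E).
  apply: ereal_inf_lbound; exists y', s'; split => //.
  move=> z [/Ays[k _ zk]|zr]; first by exists k.+1.
  by exists 0%N.
rewrite nneseries_recl//; last first.
  by move=> k _; rewrite lee_fin (gauge_ge0 gf)// mulr_gt0.
rewrite addeC leeD2r// -(nneseries_addn 1)//.
  by apply: lee_nneseries => // j _; rewrite lee_fin ?addn1// (gauge_ge0 gf) ?mulr_gt0.
by move=> k; rewrite lee_fin (gauge_ge0 gf)// mulr_gt0.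
Qed.

(** An increasing function tending to 1 never exceeds 1, and one ball covers [E]. This makes the
    content a real number [c] and later gives [1 <= c ^- 2]. *)
Lemma hausdorff_content_le1 (R : realType) (f : R -> R) (E : set R) (L : R) :
  gauge_function f -> f t @[t --> +oo] --> (1 : R) -> 0 < L -> E `<=` `[0, L] ->
  (hausdorff_content f E <= 1)%E.
Proof.
move=> gf f1 L0 EL.
have fle1 t : 0 < t -> f t <= 1.
  move=> t0; apply/ler_addgt0Pr => e e0.
  have /cvgrPdist_le/(_ _ e0)[M [_ HM]] := f1.
  set u := Num.max t (M + 1).
  have tu : t <= u by rewrite le_max lexx.
  have Mu : M < u by rewrite lt_max [M < M + 1]ltrDl ltr01 orbT.
  have := HM _ Mu; rewrite distrC ler_norml => /andP[_].
  by rewrite lerBlDl; apply: le_trans; exact: (gauge_homo gf).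
apply: (@le_trans _ _ (hausdorff_content f (set0 `|` ball 0 (L + 1)))).
  apply: le_hausdorff_content => x /EL; rewrite /= in_itv/= => /andP[x0 xL].
  by right; rewrite /ball/= sub0r normrN ger0_norm//; lra.
have L1 : 0 < L + 1 by rewrite addr_gt0.
apply: le_trans (hausdorff_content_setU_ball _ _ gf L1) _.
by rewrite hausdorff_content_set0// add0e lee_fin fle1// mulr_gt0.
Qed.

(** The part of [E] in []s, t]] lies in the open ball centred at [t] of radius [t - s]; its diameter
    is the source of the factor 2 inside [f]. *)
Lemma hausdorff_content_truncation (R : realType) (f : R -> R) (E : set R)
    (s t : R) : gauge_function f -> s < t ->
  (hausdorff_content f (E `&` [set x | (x <= t)%R])
   <= hausdorff_content f (E `&` [set x | (x <= s)%R]) + (f (2 * (t - s)))%:E)%E.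
Proof.
move=> gf st.
apply: le_trans (hausdorff_content_setU_ball _ t gf _); last by rewrite subr_gt0.
apply: le_hausdorff_content => x [Ex /= xt].
have [xs|sx] := leP x s; [by left|right].
by rewrite /ball/= ger0_norm; lra.
Qed.

(* The content of [E `&` ]-oo, t]] takes all values between 0 and that of [E]; using
   every other interval of length [c / (2 * n)] keeps neighbouring points apart. *)
Lemma hausdorff_content_separated (R : realType) (f : R -> R) (E : set R)
    (L : R) (n : nat) :
  gauge_function f -> 0 < L -> E `<=` `[0, L] ->
  (0 < hausdorff_content f E)%E -> (hausdorff_content f E < +oo)%E -> (0 < n)%N ->
  exists x : nat -> R,
    (forall i, (i < n)%N -> E (x i)) /\
    (forall i j, (i < j < n)%N -> x i < x j /\
      fine (hausdorff_content f E) * (j - i)%:R / (2 * n)%:R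
        <= f (2 * (x j - x i))).
Proof.
move=> gf L0 EL c0 coo n0.
set c := fine (hausdorff_content f E).
have cE : hausdorff_content f E = c%:E.
  by rewrite /c fineK// ge0_fin_numE// ltW.
have {}c0 : 0 < c by rewrite -lte_fin -cE.
pose Et t := E `&` [set x | x <= t].
pose F t := fine (hausdorff_content f (Et t)).
have Ffin t : hausdorff_content f (Et t) = (F t)%:E.
  rewrite /F fineK// ge0_fin_numE ?hausdorff_content_ge0//.
  by apply: le_lt_trans coo; apply: le_hausdorff_content => x [].
have Fmono s t : s <= t -> F s <= F t.
  move=> st; rewrite -lee_fin -!Ffin; apply: le_hausdorff_content => x [Ex /= xs].
  by split => //=; exact: le_trans st.
have Fincr s t : s < t -> F t <= F s + f (2 * (t - s)).
  move=> st; rewrite -lee_fin EFinD -!Ffin.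
  exact: hausdorff_content_truncation.
have Fcont : continuous F.
  move=> t; apply/cvgrPdist_le => e e0.
  have [r r0 fr] := gauge_small gf e0.
  near=> s; have [<-|st] := eqVneq t s; first by rewrite subrr normr0 ltW.
  have /fr fe : 2 * `|t - s| <= r.
    rewrite -ler_pdivlMl//; near: s.
    by apply: cvgr_dist_le; [exact: cvg_id|rewrite mulr_gt0// invr_gt0].
  have {}fe : f (2 * `|t - s|) <= e by apply: fe; rewrite mulr_gt0// normr_gt0 subr_eq0.
  move: st; rewrite neq_lt => /orP[] lt.
    rewrite distrC ger0_norm ?subr_ge0 ?Fmono ?(ltW lt)// lerBlDl.
    apply: le_trans (Fincr _ _ lt) _.
    by rewrite lerD2l -[s - t]gtr0_norm ?subr_gt0// distrC.
  rewrite ger0_norm ?subr_ge0 ?Fmono ?(ltW lt)// lerBlDl.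
  by apply: le_trans (Fincr _ _ lt) _; rewrite lerD2l -[t - s]gtr0_norm ?subr_gt0.
(* [-1] lies to the left of [[0, L]], which gives the intermediate value theorem its lower value
   0. *)
have F0 : F (-1) = 0.
  rewrite /F (_ : Et _ = set0) ?hausdorff_content_set0//.
  rewrite -subset0 => x [/EL]; rewrite /= in_itv/= => /andP[x0 _] x1.
  by have : (0 : R) <= -1 := le_trans x0 x1; lra.
have FL : F L = c.
  rewrite /F (_ : Et _ = E)//; apply/seteqP; split => [x []//|x Ex]; split => //.
  by have := EL _ Ex; rewrite /= in_itv/= => /andP[].
(* The points [s] and [t] where [F] takes the values [a] and [b] need not lie in [E]. But if [E] had
   no point in []s, t]], both truncations would be the same set and [F s = F t]. *)
have hit a b : 0 <= a -> a < b -> b <= c -> exists x, E x /\ a <= F x <= b.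
  move=> a0 ab bc.
  have ivt v : 0 <= v -> v <= c -> exists s, F s = v.
    move=> v0 vc; have [|||s _ <-] := @IVT _ F (-1) L v; last by exists s.
    - lra.
    - exact: continuous_subspaceT.
    - by rewrite F0 FL minEle maxEle (ltW c0) v0 vc.
  have [s Fs] := ivt a a0 (le_trans (ltW ab) bc).
  have [t Ft] := ivt b (le_trans a0 (ltW ab)) bc.
  have st : s < t by rewrite ltNge; apply/negP => /Fmono; rewrite Fs Ft leNgt ab.
  apply: contrapT => /forallNP noE.
  suff : F t <= F s by rewrite Fs Ft leNgt ab.
  rewrite -lee_fin -!Ffin; apply: le_hausdorff_content => x [Ex /= xt].
  split => //=; rewrite leNgt; apply/negP => sx; apply: (noE x); split => //.
  by rewrite -Fs -Ft !Fmono// ltW.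
have n2 : 0 < (2 * n)%:R :> R by rewrite ltr0n muln_gt0.
have /choice[x xP] : forall i, exists x, (i < n)%N ->
    E x /\ c * (2 * i)%:R / (2 * n)%:R <= F x <= c * (2 * i).+1%:R / (2 * n)%:R.
  move=> i; have [iN|] := ltnP i n; last by exists 0.
  have [|||x Hx] := hit (c * (2 * i)%:R / (2 * n)%:R) (c * (2 * i).+1%:R / (2 * n)%:R).
  - by rewrite divr_ge0// mulr_ge0// ltW.
  - by rewrite ltr_pM2r ?invr_gt0// ltr_pM2l// ltr_nat.
  - rewrite ler_pdivrMr// ler_pM2l// ler_nat.
    by rewrite (@leq_trans (2 * i.+1)%N)// ?leq_mul2l// mulnS addSn ltnS addnC leq_addr.
  - by exists x.
exists x; split => [i /xP[]//|i j /andP[ij jn]].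
have [Ei /andP[_ Fi]] := xP i (ltn_trans ij jn).
have [Ej /andP[Fj _]] := xP j jn.
(* The gap between interval [i] and interval [j] is [2 * (j - i) - 1] units of [c / (2 * n)], at
   least [j - i] units since [i < j]. *)
have gap : c * (j - i)%:R / (2 * n)%:R <= F (x j) - F (x i).
  apply: le_trans (lerB Fj Fi).
  rewrite -mulrBl -mulrBr ler_pM2r ?invr_gt0// ler_pM2l// natrB ?(ltnW ij)//.
  have : (i.+1)%:R <= j%:R :> R by rewrite ler_nat.
  by rewrite -!natr1 !natrM; lra.
have xij : x i < x j.
  rewrite ltNge; apply/negP => /Fmono; rewrite leNgt => /negP; apply.
  by rewrite -subr_gt0 (lt_le_trans _ gap)// divr_gt0// mulr_gt0// ltr0n subn_gt0.
split => //; apply: le_trans gap _.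
by rewrite lerBlDl; exact: Fincr.
Unshelve. all: by end_near. Qed.

(** * Lagrange interpolation and trigonometric polynomials *)

(** The difference [q] of [p] and its interpolant has size at most [n] and vanishes at [n] distinct
    nodes, so it is zero. *)
Lemma lagrange_interpolation (K : fieldType) (n : nat) (y : 'I_n -> K)
    (p : {poly K}) (z : K) : injective y -> (size p <= n)%N ->
  p.[z] = \sum_(i < n) p.[y i] * \prod_(j < n | j != i) ((z - y j) / (y i - y j)).
Proof.
move=> yinj pn.
pose l i : {poly K} := \prod_(j < n | j != i) ((y i - y j)^-1 *: ('X - (y j)%:P)).
have lE i w : (l i).[w] = \prod_(j < n | j != i) ((w - y j) / (y i - y j)).
  rewrite /l horner_prod; apply: eq_bigr => j _.
  by rewrite hornerZ hornerXsubC mulrC.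
pose q := p - \sum_(i < n) p.[y i] *: l i.
suff q0 : q = 0.
  have -> : p = \sum_(i < n) p.[y i] *: l i.
    by apply/eqP; rewrite -subr_eq0 -/q q0.
  rewrite horner_sum; apply: eq_bigr => i _; rewrite hornerZ lE.
  congr (_ * _); rewrite horner_sum (bigD1 i)//= big1 ?addr0.
    rewrite hornerZ lE big1 ?mulr1// => j ji.
    by rewrite divff// subr_eq0 (inj_eq yinj) eq_sym.
  move=> j ji; rewrite hornerZ lE (bigD1 i) 1?eq_sym//= subrr mul0r mul0r.
  by rewrite mulr0.
apply/eqP; apply: contraT => q0.
have roots : all (root q) [seq y i | i <- enum 'I_n].
  apply/allP => _ /mapP[i _ ->]; rewrite rootE /q hornerD hornerN horner_sum.
  rewrite (bigD1 i)//= big1 ?addr0; last first.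
    move=> j ji; rewrite hornerZ lE (bigD1 i) 1?eq_sym//= subrr mul0r mul0r.
    by rewrite mulr0.
  rewrite hornerZ lE big1 ?mulr1 ?subrr// => j ji.
  by rewrite divff// subr_eq0 (inj_eq yinj) eq_sym.
have := max_poly_roots q0 roots.
rewrite map_inj_uniq// enum_uniq size_map size_enum_ord ltnNge => /(_ isT)/negP[].
rewrite (leq_trans (size_polyD _ _))// geq_max pn/= size_polyN.
apply: (leq_trans (size_sum _ _ _)); apply/bigmax_leqP => i _.
apply: (leq_trans (size_scale_leq _ _)).
rewrite /l scaler_prod; apply: (leq_trans (size_scale_leq _ _)).
rewrite size_prod; last by move=> j _; rewrite polyXsubC_eq0.
under eq_bigr do rewrite size_XsubC.
rewrite sum_nat_const cardC1 card_ord.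
have n0 : (0 < n)%N := leq_ltn_trans (leq0n i) (ltn_ord i).
by rewrite muln2 -addnn -addSn addnK prednK.
Qed.

(** [t] and [u] are the Chebyshev polynomials of the first kind (degree [k]) and second kind (degree
    [k - 1]). The addition formulas couple them, so one induction builds both. *)
Lemma chebyshev_poly (R : realType) (k : nat) :
  exists t u : {poly R}, [/\ (size t <= k.+1)%N, (size u <= k)%N &
    forall x : R, cos (k%:R * x) = t.[cos x] /\ sin (k%:R * x) = sin x * u.[cos x]].
Proof.
elim: k => [|k [t [u [st su tu]]]].
  exists 1, 0; split; rewrite ?size_poly1 ?size_poly0// => x.
  by rewrite mul0r cos0 sin0 hornerC horner0 mulr0.
have sX2 : (size (1 - 'X ^+ 2 : {poly R})%R <= 3)%N.
  rewrite (leq_trans (size_polyD _ _))// geq_max size_poly1/=.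
  by rewrite size_polyN size_polyXn.
exists (t * 'X - (1 - 'X ^+ 2) * u), (u * 'X + t); split.
- rewrite (leq_trans (size_polyD _ _))// geq_max size_polyN; apply/andP; split.
    rewrite (leq_trans (size_polyMleq _ _))// size_polyX addn2/=.
    by rewrite ltnS.
  rewrite (leq_trans (size_polyMleq _ _))//.
  by rewrite -subn1 leq_subLR (leq_trans (leq_add sX2 su)).
- rewrite (leq_trans (size_polyD _ _))// geq_max st andbT.
  rewrite (leq_trans (size_polyMleq _ _))// size_polyX addn2/=.
  by rewrite ltnS.
move=> x; have [cE sE] := tu x.
rewrite -natr1 mulrDl mul1r cosD sinD cE sE !hornerE; split.
  by rewrite -sin2cos2; ring.
by ring.
Qed.

(** With [v = u / 2], the mean value theorem gives [v * cos v <= sin v]. Hence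
    [sin u = 2 sin v cos v] is at least [v * (2 cos^2 v) = v * (1 + cos u)], and [cos u] is
    nonnegative. *)
Lemma half_le_sin (R : realType) (u : R) : 0 <= u <= pi / 2 -> u / 2 <= sin u.
Proof.
move=> /andP[u0 u1]; set v := u / 2.
have v0 : 0 <= v by rewrite divr_ge0.
have vpi : v <= pi / 2 / 2 by rewrite ler_pM2r.
have p0 := pi_ge0 R.
have [w] := @MVT_segment R sin cos 0 v v0 (fun x _ => is_derive_sin x)
  (continuous_subspaceT (@continuous_sin R)).
rewrite in_itv/= => /andP[w0 wv]; rewrite sin0 !subr0 => sE.
have cvw : cos v <= cos w.
  move: wv; rewrite le_eqVlt => /predU1P[->//|wv]; apply/ltW.
  by rewrite ltr_cos// in_itv/= ?w0 ?v0/=; lra.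
have cu : 0 <= cos u by apply: cos_ge0_pihalf; lra.
have cv : 0 <= cos v by apply: cos_ge0_pihalf; lra.
have uE : u = v *+ 2 by rewrite /v -mulr_natr divfK.
move: cu; rewrite {2}uE sin_mulr2n uE cos_mulr2n => cu.
have cv2 : 1 <= cos v ^+ 2 *+ 2 by lra.
apply: (@le_trans _ _ (v * (cos v ^+ 2 *+ 2))); first by rewrite ler_peMr.
have h : v * cos v <= sin v by rewrite sE [leRHS]mulrC ler_wpM2l.
have -> : v * (cos v ^+ 2 *+ 2) = (cos v * (v * cos v)) *+ 2 by ring.
by rewrite lerMn2r/= ler_wpM2l.
Qed.

(** In [cos a - cos b = - 2 sin v sin w] both sines are at least [w / 2], because [w] is at most
    both [v] and [pi - v]. The bound is quadratic since cosine is flat at 0 and [pi]. *)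
Lemma cos_separation (R : realType) (a b : R) : 0 <= a <= pi -> 0 <= b <= pi ->
  (a - b) ^+ 2 / 8 <= `|cos a - cos b|.
Proof.
wlog ba : a b / b <= a.
  move=> H a0 b0; have [/H|/ltW/H] := leP b a; first exact.
  by rewrite distrC -[a - b]opprB sqrrN; exact.
move=> /andP[a0 a1] /andP[b0 b1].
set v := (a + b) / 2; set w := (a - b) / 2.
have w0 : 0 <= w by rewrite /w; lra.
have sw : w / 2 <= sin w by apply: half_le_sin; rewrite w0/=/w; lra.
have sv : w / 2 <= sin v.
  have [vpi|vpi] := leP v (pi / 2).
    have : v / 2 <= sin v by apply: half_le_sin; rewrite vpi andbT /v; lra.
    by apply: le_trans; rewrite /w /v; lra.
  have -> : sin v = sin (pi - v) by rewrite sinB sinpi cospi; ring.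
  have : (pi - v) / 2 <= sin (pi - v) by apply: half_le_sin; rewrite /v in vpi *; lra.
  by apply: le_trans; rewrite /w /v; lra.
have -> : cos a - cos b = - (2 * (sin v * sin w)).
  have -> : a = v + w by rewrite /v /w; lra.
  have -> : b = v - w by rewrite /v /w; lra.
  by rewrite cosD cosB; ring.
have w2 : 0 <= w / 2 by lra.
rewrite normrN ger0_norm; last by rewrite !mulr_ge0// (le_trans w2).
apply: (@le_trans _ _ (2 * (w / 2 * (w / 2)))).
  by rewrite /w; lra.
by rewrite ler_pM2l// ler_pM.
Qed.

Lemma spectral_space_poly (R : realType) (L lambda : R) (N : nat) (phi : R -> R) :
  (forall k : nat, dirichlet_eigenvalue L k <= lambda -> (k <= N)%N) ->
  spectral_space L lambda phi ->
  exists2 q : {poly R}, (size q <= N)%N &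
    forall x, phi x = sin (pi * x / L) * q.[cos (pi * x / L)].
Proof.
move=> HN [n [c [v [vE ->]]]].
have /choice[u uP] : forall i : 'I_n, exists u : {poly R}, (size u <= N)%N /\
    forall x, v i x = sin (pi * x / L) * u.[cos (pi * x / L)].
  move=> i; have [k [_ kl] <-] := vE i.
  have [t [u [_ su uE]]] := chebyshev_poly R k.
  exists u; split; first exact: leq_trans (HN _ kl).
  move=> z; have [_ <-] := uE (pi * z / L).
  by rewrite /dirichlet_eigenfunction !mulrA.
exists (\sum_(i < n) c i *: u i).
  apply: (leq_trans (size_sum _ _ _)); apply/bigmax_leqP => i _.
  by apply: (leq_trans (size_scale_leq _ _)); case: (uP i).
move=> x; rewrite horner_sum mulr_sumr; apply: eq_bigr => i _.
by rewrite hornerZ (uP i).2 mulrCA.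
Qed.

(** The sine factor keeps [phi] from being a polynomial in the cosine; squaring turns it into
    [1 - 'X ^+ 2]. The square also matches the quadratic separation of cosines, so [D] enters as
    [D ^+ 2]. *)
Lemma spectral_interpolation (R : realType) (L lambda M D : R) (N : nat)
    (phi : R -> R) (x : 'I_(2 * N).+1 -> R) :
  0 < L -> (0 < N)%N ->
  (forall k : nat, dirichlet_eigenvalue L k <= lambda -> (k <= N)%N) ->
  spectral_space L lambda phi ->
  injective x -> (forall i, 0 <= x i <= L) -> (forall i, `|phi (x i)| <= M) ->
  (forall i, \prod_(j | j != i) (2 * L / `|x i - x j|) <= D) ->
  forall z, 0 <= z <= L -> phi z ^+ 2 <= (2 * N).+1%:R * (D * M) ^+ 2.
Proof.
move=> L0 N0 HN phiS xinj x01 phiM HD z z01.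
have [q sq phiE] := spectral_space_poly HN phiS.
pose th (w : R) := pi * w / L.
have th0pi w : 0 <= w <= L -> 0 <= th w <= pi.
  move=> /andP[w0 w1]; rewrite /th divr_ge0 ?mulr_ge0 ?pi_ge0 ?(ltW L0)//=.
  by rewrite ler_pdivrMr// ler_wpM2l// pi_ge0.
(* The constant comes from [pi ^+ 2 / 8 >= 1 / 2]. *)
have sep a b : 0 <= a <= L -> 0 <= b <= L ->
    (a - b) ^+ 2 / (2 * L ^+ 2) <= `|cos (th a) - cos (th b)|.
  move=> a0 b0; apply: le_trans (cos_separation (th0pi _ a0) (th0pi _ b0)).
  have -> : th a - th b = pi * ((a - b) / L) by rewrite /th; field; rewrite gt_eqF.
  rewrite exprMn.
  apply: (@le_trans _ _ (2 ^+ 2 * ((a - b) / L) ^+ 2 / 8)).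
    by rewrite le_eqVlt; apply/orP; left; apply/eqP; field; rewrite gt_eqF.
  rewrite ler_pM2r ?invr_gt0// ler_wpM2r ?sqr_ge0//.
  by rewrite lerXn2r ?nnegrE ?pi_ge0// pi_ge2.
pose y i := cos (th (x i)).
have xneq i j : j != i -> 0 < `|x i - x j|.
  by move=> ji; rewrite normr_gt0 subr_eq0 (inj_eq xinj) eq_sym.
have yneq i j : j != i -> 0 < `|y i - y j|.
  move=> ji; apply: lt_le_trans (sep _ _ (x01 i) (x01 j)).
  rewrite -real_normK ?num_real// divr_gt0// ?exprn_gt0 ?xneq//.
  by rewrite mulr_gt0// exprn_gt0.
have yinj : injective y.
  move=> i j yij; apply/eqP; apply: contraT => ij.
  by have := yneq _ _ ij; rewrite yij subrr normr0 ltxx.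
pose p : {poly R} := (1 - 'X ^+ 2) * (q * q).
have pE w : phi w ^+ 2 = p.[cos (th w)].
  rewrite phiE exprMn /p !hornerE -/(th w) sin2cos2; ring.
have sp : (size p <= (2 * N).+1)%N.
  have sX2 : (size (1 - 'X ^+ 2 : {poly R})%R <= 3)%N.
    rewrite (leq_trans (size_polyD _ _))// geq_max size_poly1/=.
    by rewrite size_polyN size_polyXn.
  have sqq : (size (q * q)%R <= (2 * N).-1)%N.
    apply: (leq_trans (size_polyMleq _ _)).
    by rewrite -!subn1 leq_sub2r// mul2n -addnn leq_add.
  apply: (leq_trans (size_polyMleq _ _)).
  rewrite -subn1 leq_subLR add1n (leq_trans (leq_add sX2 sqq))//.
  by case: (N) N0 => // m _; rewrite mulnS.
have M0 : 0 <= M by apply: le_trans (phiM ord0).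
rewrite pE (lagrange_interpolation _ yinj sp).
apply: (@le_trans _ _ (\sum_(i < (2 * N).+1) (D * M) ^+ 2)); last first.
  by rewrite sumr_const card_ord mulr_natl.
apply: ler_sum => i _; apply: (le_trans (ler_norm _)).
rewrite normrM -pE normrX normr_prod mulrC exprMn ler_pM//.
- by apply: prodr_ge0 => j _.
- have P0 : 0 <= \prod_(j | j != i) (2 * L / `|x i - x j|).
    by apply: prodr_ge0 => j _; rewrite divr_ge0// mulr_ge0// ltW.
  (* Each factor has numerator at most 2, as a difference of cosines, and denominator bounded below
     by [sep]; the quotient is at most [(2 * L / |x i - x j|) ^+ 2]. *)
  apply: (@le_trans _ _ ((\prod_(j | j != i) (2 * L / `|x i - x j|)) ^+ 2)).
    rewrite -prodrXl; apply: ler_prod => j ji; rewrite normr_ge0/=.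
    rewrite normf_div ler_pdivrMr ?yneq//.
    apply: (@le_trans _ _ 2).
      apply: (le_trans (ler_normB _ _)).
      by rewrite (lerD (cos_max _) (cos_max _)).
    apply: (@le_trans _ _ ((2 * L / `|x i - x j|) ^+ 2 *
        ((x i - x j) ^+ 2 / (2 * L ^+ 2)))).
      rewrite -[(x i - x j) ^+ 2]real_normK ?num_real//.
      rewrite le_eqVlt; apply/orP; left; apply/eqP; field.
      by rewrite !gt_eqF// xneq.
    by rewrite ler_wpM2l ?sqr_ge0// sep.
  by rewrite lerXn2r ?nnegrE// (le_trans P0).
- by rewrite lerXn2r ?nnegrE.
Qed.

(** * Estimates for powers, logarithms and sums of inverse squares *)

Lemma powRN_anti (R : realType) (a x y : R) : 0 <= a -> 0 < x -> x <= y ->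
  y `^ (- a) <= x `^ (- a).
Proof.
move=> a0 x0 xy; have y0 := lt_le_trans x0 xy.
rewrite !powRN lef_pV2 ?posrE ?powR_gt0//.
by apply: ge0_ler_powR; rewrite ?nnegrE // ltW.
Qed.

(** Apply [ln w <= w] to [w = u / (4 * b)]. For [u = ln (lambda + e)] it bounds a power of the
    logarithm by [(lambda + e)^(1/4)]. *)
Lemma powR_le_expR (R : realType) (b u : R) : 0 < b -> 0 < u ->
  u `^ b <= (4 * b) `^ b * expR (u / 4).
Proof.
move=> b0 u0; have b4 : 0 < 4 * b by rewrite mulr_gt0.
have uE : u = 4 * b * (u / (4 * b)) by field; rewrite gt_eqF.
rewrite [in leLHS]uE powRM ?divr_ge0 ?(ltW b4) ?(ltW u0)// ler_wpM2l ?powR_ge0//.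
rewrite /powR gt_eqF ?divr_gt0// ler_expR.
have : ln (u / (4 * b)) <= u / (4 * b).
  have w0 : 0 < u / (4 * b) by rewrite divr_gt0.
  have := @le_ln1Dx R (u / (4 * b) - 1); rewrite (addrC 1) subrK => lnw; have := lnw ltac:(lra); lra.
move=> /(ler_wpM2l (ltW b0)) /le_trans; apply.
by rewrite le_eqVlt; apply/orP; left; apply/eqP; field; rewrite gt_eqF.
Qed.

(* [u] is a free cutoff for [ln (ln t^-1)]; in the application it is a quarter of
   [ln (lambda + e)], whatever the pair of nodes at distance [t]. *)
Lemma is_h_alpha_ln_le (R : realType) (alpha t g u : R) (h : R -> R) :
  0 < alpha -> is_h_alpha alpha h -> 0 < t -> 0 < g -> g <= h t -> 0 < u ->
  ln t^-1 <= 3 + expR u + g ^- 2 * u `^ (- (2 * alpha)).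
Proof.
move=> a0 [_ hE _] t0 g0 gh u0.
have e0 := expR_gt0 u.
have P0 : 0 <= g ^- 2 * u `^ (- (2 * alpha)).
  by rewrite mulr_ge0 ?powR_ge0// invr_ge0 sqr_ge0.
(* Each summand serves one case: [t] above [expR (- 3)]; [s <= expR u]; and otherwise [u <= ln s],
   where squaring the lower bound on [h t] and solving for [s] gives the last one. *)
have [t3|t3] := leP t (expR (- 3)); last first.
  have : ln t^-1 <= 3.
    by rewrite lnV ?posrE// lerNl -[- 3]expRK ler_ln ?posrE ?expR_gt0 ?ltW.
  by lra.
have s3 : 3 <= ln t^-1.
  by rewrite lnV ?posrE// lerNr -[- 3]expRK ler_ln ?posrE ?expR_gt0.
move: gh; rewrite hE//; set s := ln t^-1 in s3 *.
have s0 : 0 < s by lra.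
move=> gh; have [su|us] := leP s (expR u); first by lra.
have uls : u <= ln s by rewrite -[u]expRK ler_ln ?posrE ?expR_gt0// ltW.
have {}gh : g <= s `^ (- (1 / 2)) * u `^ (- alpha).
  by apply: (le_trans gh); rewrite ler_wpM2l ?powR_ge0// powRN_anti// ltW.
have {}gh : g ^+ 2 <= s^-1 * u `^ (- (2 * alpha)).
  have -> : s^-1 * u `^ (- (2 * alpha)) = (s `^ (- (1 / 2)) * u `^ (- alpha)) ^+ 2.
    rewrite exprMn -!powR_mulrn ?powR_ge0// -!powRrM; congr (_ * _).
      by rewrite -[s^-1]powR_inv1 ?(ltW s0)//; congr (_ `^ _); lra.
    by congr (_ `^ _); lra.
  by rewrite lerXn2r ?nnegrE ?mulr_ge0 ?powR_ge0 ?(ltW g0).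
suff : s <= g ^- 2 * u `^ (- (2 * alpha)) by lra.
by rewrite mulrC ler_pdivlMr ?exprn_gt0// mulrC -ler_pdivlMr// mulrC.
Qed.

Lemma sum_inv_sq_le2 (R : realFieldType) (m : nat) :
  \sum_(0 <= k < m) ((k.+1)%:R ^- 2 : R) <= 2.
Proof.
(* The sharper bound is inductive because [1 / x^2 <= 2 / x - 2 / (x + 1)] for [x >= 1]. *)
suff : \sum_(0 <= k < m) ((k.+1)%:R ^- 2 : R) <= 2 - 2 / (m.+1)%:R.
  by move=> /le_trans; apply; rewrite lerBlDr lerDl divr_ge0.
elim: m => [|m IH]; first by rewrite big_nil divr1 subrr.
rewrite big_nat_recr//=; apply: (le_trans (lerD IH (lexx _))).
rewrite -[m.+2%:R]natr1; set x : R := m.+1%:R.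
have x1 : 1 <= x by rewrite ler1n.
rewrite -subr_ge0.
have -> : 2 - 2 / (x + 1) - (2 - 2 / x + x ^- 2) = (x - 1) / (x ^+ 2 * (x + 1)).
  by field; rewrite !gt_eqF//; lra.
by rewrite divr_ge0 ?mulr_ge0 ?sqr_ge0//; lra.
Qed.

(** With truncated subtraction [(i - j) + (j - i)] is the distance of the indices; those below and
    those above [i] contribute at most 2 each. *)
Lemma sum_inv_dist_sq_le4 (R : realFieldType) (n : nat) (i : 'I_n) :
  \sum_(j < n | j != i) (((i - j) + (j - i))%:R ^- 2 : R) <= 4.
Proof.
rewrite -(big_mkord (fun j => j != i) (fun j => ((i - j) + (j - i))%:R ^- 2 : R)).
rewrite (@big_cat_nat _ _ _ i)//= ?(ltnW (ltn_ord i))//.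
rewrite [X in _ + X]big_ltn_cond//= eqxx/=.
have -> : 4 = 2 + 2 :> R by lra.
apply: lerD.
  rewrite big_nat_rev/= add0n; apply: le_trans (sum_inv_sq_le2 R i).
  rewrite big_mkcond/= big_nat [leRHS]big_nat; apply: ler_sum => k /andP[_ ki].
  case: ifP => _; last by rewrite invr_ge0 sqr_ge0.
  by rewrite subKn// (eqP (leq_subr _ _)) addn0.
apply: le_trans (sum_inv_sq_le2 R (n - i.+1)).
rewrite -[X in \sum_(X <= _ < _ | _) _]add0n big_addn big_mkcond/= big_nat [leRHS]big_nat.
apply: ler_sum => k _.
case: ifP => _; last by rewrite invr_ge0 sqr_ge0.
have -> : (i - (k + i.+1) + (k + i.+1 - i) = k.+1)%N by rewrite addnS -addSn addnK -[X in (X - _)%N]add0n subnDr.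
by [].
Qed.

(** * Suprema over the spectral space and growth in [lambda] *)

(** [sup] takes a default value on unbounded sets; this bound ensures that [sup_abs] really
    dominates the values of [phi]. *)
Lemma spectral_space_bounded (R : realType) (L lambda : R) (phi : R -> R) :
  spectral_space L lambda phi -> exists B, forall x, `|phi x| <= B.
Proof.
move=> [n [c [v [vE ->]]]]; exists (\sum_(i < n) `|c i|) => x.
apply: (le_trans (ler_norm_sum _ _ _)); apply: ler_sum => i _.
have [k _ <-] := vE i.
by rewrite normrM ler_piMr// sin_max.
Qed.

Lemma le_sup_abs (R : realType) (A : set R) (phi : R -> R) (B x : R) :
  (forall y, `|phi y| <= B) -> A x -> `|phi x| <= sup_abs A phi.
Proof.
move=> phiB Ax; apply: ub_le_sup; last by exists x.
by exists B => _ [y _ <-].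
Qed.

Lemma sup_abs_le (R : realType) (A : set R) (phi : R -> R) (B x : R) :
  A x -> (forall y, A y -> `|phi y| <= B) -> sup_abs A phi <= B.
Proof.
move=> Ax phiB; apply: ge_sup; first by exists `|phi x|, x.
by move=> _ [y /phiB ? <-].
Qed.

(** The left side is [lambda^(1/2) (lambda + e)^(1/4)], the error left by the cutoff. For
    [lambda <= 1] the first term suffices; for larger [lambda] the spare power of [lambda] absorbs
    the logarithm. *)
Lemma sqrt_expR_le (R : realType) (b lambda : R) : 0 < b -> 0 < lambda ->
  Num.sqrt lambda * expR (ln (lambda + expR 1) / 4) <=
    expR 1 * Num.sqrt lambda +
    expR 1 * (4 * b) `^ b * (lambda * ln (lambda + expR 1) `^ (- b)).
Proof.
move=> b0 l0; set r := Num.sqrt lambda; set l := ln _.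
have e2 : 2 <= expR 1 :> R by have := expR_ge1Dx (1 : R); lra.
have r0 : 0 < r by rewrite sqrtr_gt0.
have rE : r ^+ 2 = lambda by rewrite sqr_sqrtr// ltW.
have le0 : 0 < lambda + expR 1 by rewrite addr_gt0// expR_gt0.
have lE : expR l = lambda + expR 1 by rewrite lnK.
have l1 : 1 <= l by rewrite -[1]expRK ler_ln ?posrE ?expR_gt0// lerDr ltW.
have C0 : 0 <= (4 * b) `^ b by rewrite powR_ge0.
have W0 : 0 < l `^ (- b) by rewrite powR_gt0; lra.
have [l2|l2] := leP lambda 1.
  have : expR (l / 4) <= expR 1.
    rewrite ler_expR; suff : l <= 2 by lra.
    rewrite -ler_expR lE; have -> : 2 = 1 + 1 :> R by lra.
    rewrite expRD; apply: (@le_trans _ _ (2 * expR 1)); first by lra.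
    by rewrite ler_pM2r// expR_gt0.
  move=> /(ler_wpM2l (ltW r0)) h; apply: (le_trans h).
  rewrite mulrC lerDl !mulr_ge0// ?expR_ge0// ltW//.
have key : l `^ b <= (4 * b) `^ b * expR (l / 4) by apply: powR_le_expR; lra.
(* That is, [lambda + e <= e^2 lambda], after taking square roots. *)
have half : expR (l / 4) ^+ 2 <= r * expR 1.
  rewrite -[leLHS]ger0_norm ?sqr_ge0// -[leRHS]ger0_norm ?mulr_ge0 ?expR_ge0 ?(ltW r0)//.
  rewrite -ler_sqr ?nnegrE// !real_normK ?num_real//.
  rewrite -exprM -expRM_natl exprMn rE.
  have -> : (2 * 2)%N%:R * (l / 4) = l :> R by rewrite natrM; field.
  rewrite lE.
  have : 2 * 2 <= expR 1 * expR 1 :> R by apply: ler_pM => //; lra.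
  have : 0 <= (lambda - 1) * (expR 1 - 1) by rewrite mulr_ge0//; lra.
  have : 0 <= lambda * (expR 1 * (expR 1 - 2)) by rewrite !mulr_ge0 ?(ltW l0)//; lra.
  rewrite expr2; nra.
suff : r * expR (l / 4) <= expR 1 * (4 * b) `^ b * (lambda * l `^ (- b)).
  by move=> /le_trans; apply; rewrite lerDr mulr_ge0 ?expR_ge0// ltW.
have -> : expR 1 * (4 * b) `^ b * (lambda * l `^ (- b))
    = expR 1 * (4 * b) `^ b * lambda / l `^ b by rewrite powRN mulrA.
rewrite ler_pdivlMr; last by rewrite powR_gt0; lra.
apply: (@le_trans _ _ (r * expR (l / 4) * ((4 * b) `^ b * expR (l / 4)))).
  by rewrite ler_wpM2l// mulr_ge0 ?expR_ge0// ltW.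
have -> : r * expR (l / 4) * ((4 * b) `^ b * expR (l / 4))
    = r * (4 * b) `^ b * expR (l / 4) ^+ 2 by ring.
have -> : expR 1 * (4 * b) `^ b * lambda = r * (4 * b) `^ b * (r * expR 1).
  by rewrite -rE; ring.
by rewrite ler_wpM2l// mulr_ge0// ltW.
Qed.

(** * Products over the nodes and the final inequality *)

Lemma nodes_product_le (R : realType) (alpha u : R) (h : R -> R) (L : R)
    (E : set R) (n : nat) :
  0 < alpha -> 0 < u -> is_h_alpha alpha h -> 0 < L -> E `<=` `[0, L] ->
  (0 < hausdorff_content h E)%E -> (0 < n)%N ->
  exists x : 'I_n -> R, [/\ injective x, (forall i, E (x i)) &
    forall i, \prod_(j < n | j != i) (2 * L / `|x i - x j|) <=
      expR (n%:R * (4 * L + 3 + expR u) +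
        16 * n%:R ^+ 2 * u `^ (- (2 * alpha)) / fine (hausdorff_content h E) ^+ 2)].
Proof.
move=> a0 u0 hh L0 EL c0 n0; have [gh _ h1] := hh.
have coo : (hausdorff_content h E < +oo)%E.
  exact: le_lt_trans (hausdorff_content_le1 gh h1 L0 EL) (ltry _).
have [x [Ex xsep]] := hausdorff_content_separated gh L0 EL c0 coo n0.
set c := fine (hausdorff_content h E) in xsep *.
have {}c0 : 0 < c by rewrite fine_gt0 ?c0.
have nR0 : 0 < n%:R :> R by rewrite ltr0n.
have sep (i j : 'I_n) : j != i -> x i != x j /\
    c * (i - j + (j - i))%:R / (2 * n)%:R <= h (2 * `|x i - x j|).
  rewrite neq_ltn => /orP[ji|ij].
    have [|xji hc] := xsep j i; first by rewrite ji ltn_ord.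
    rewrite gt_eqF// gtr0_norm ?subr_gt0//; split => //.
    by have /eqP -> : (j - i == 0)%N; rewrite ?addn0// subn_eq0 ltnW.
  have [|xij hc] := xsep i j; first by rewrite ij ltn_ord.
  rewrite lt_eqF// distrC gtr0_norm ?subr_gt0//; split => //.
  by have /eqP -> : (i - j == 0)%N; rewrite ?add0n// subn_eq0 ltnW.
exists (fun i => x i); split => [i j xij|i|i].
- by apply/eqP; apply: contraT; rewrite eq_sym => /sep[]; rewrite xij eqxx.
- exact/Ex/ltn_ord.
(* At index distance [d], taking [g = c * d / (2 * n)] in [is_h_alpha_ln_le] gives
   [g ^- 2 * u^(- 2 alpha) = b / d ^+ 2]. Summing over the other indices turns the 4 into 16. *)
set b := 4 * n%:R ^+ 2 * u `^ (- (2 * alpha)) / c ^+ 2.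
have b0 : 0 <= b.
  by rewrite /b divr_ge0 ?sqr_ge0// !mulr_ge0 ?powR_ge0 ?sqr_ge0.
have a1 : 0 <= 4 * L + 3 + expR u by have := expR_ge0 u; lra.
pose d (j : 'I_n) : R := (i - j + (j - i))%:R.
have dE j : d j = (i - j + (j - i))%:R by [].
clearbody d.
apply: (@le_trans _ _ (\prod_(j < n | j != i)
    expR (4 * L + 3 + expR u + b * d j ^- 2))).
  apply: ler_prod => j ji; have [xij] := sep i j ji; rewrite -dE => hc.
  have d0 : 0 < d j.
    rewrite dE ltr0n addn_gt0 !subn_gt0.
    by move: ji; rewrite neq_ltn.
  have x0 : 0 < `|x i - x j| by rewrite normr_gt0 subr_eq0.
  rewrite divr_ge0 ?mulr_ge0 ?(ltW L0)//=.
  set t := 2 * `|x i - x j|.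
  have t0 : 0 < t by rewrite mulr_gt0.
  have g0 : 0 < c * d j / (2 * n)%:R by rewrite divr_gt0 ?mulr_gt0// ltr0n muln_gt0.
  have lnt := is_h_alpha_ln_le a0 hh t0 g0 hc u0.
  have -> : 2 * L / `|x i - x j| = 4 * L / t by rewrite /t; field; rewrite gt_eqF.
  have -> : 4 * L + 3 + expR u + b * d j ^- 2 = 4 * L +
      (3 + expR u + (c * d j / (2 * n)%:R) ^- 2 * u `^ (- (2 * alpha))).
    by rewrite /b natrM; field; rewrite !gt_eqF.
  rewrite expRD; apply: ler_pM.
  - by rewrite mulr_ge0// ltW.
  - by rewrite invr_ge0 ltW.
  - by apply: le_trans (expR_ge1Dx _); rewrite lerDr.
  - by rewrite -[leLHS]lnK ?posrE ?invr_gt0// ler_expR.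
rewrite -expR_sum ler_expR big_split/= -mulr_sumr sumr_const; apply: lerD.
  by rewrite -[leLHS]mulr_natl ler_wpM2r// ler_nat cardC1 card_ord leq_pred.
apply: (@le_trans _ _ (b * 4)).
  under eq_bigr do rewrite dE.
  by rewrite ler_wpM2l// sum_inv_dist_sq_le4.
by rewrite le_eqVlt; apply/orP; left; apply/eqP; rewrite /b; ring.
Qed.

Theorem lemma4p1 (R : realType) (alpha : R) (halpha : 0 < alpha) :
  exists C : R, 0 < C /\
    forall h : R -> R, is_h_alpha alpha h ->
    forall (L : R) (E : set R) (lambda : R),
      0 < L -> E `<=` `[0, L] -> (0 < hausdorff_content h E)%E -> 0 < lambda ->
      forall phi : R -> R, spectral_space L lambda phi ->
        sup_abs `[0, L] phi <=
          expR (C * (L + 1) ^+ 2 * Num.sqrt lambda) *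
          expR (C * (L + 1) ^+ 2 * lambda *
                  (ln (lambda + expR 1)) `^ (- (2 * alpha / 3)) /
                (fine (hausdorff_content h E)) ^+ 2) *
          sup_abs E phi.
Proof.
set b := 2 * alpha / 3.
have b0 : 0 < b by rewrite /b; lra.
set K1 := expR 1 * (4 * b) `^ b; set K2 := 4 `^ (2 * alpha) : R.
have K10 : 0 <= K1 by rewrite mulr_ge0 ?expR_ge0 ?powR_ge0.
have K20 : 0 <= K2 by rewrite powR_ge0.
have e0 : 0 < expR 1 :> R := expR_gt0 _.
(* The summand 10 pays for [n * (4 * L + 4)], the terms in [expR 1] and [K1] for [n * expR (l / 4)],
   and [64 * K2] for the part quadratic in [n], with [K2] undoing the quarter in [l / 4]. *)
exists (10 + 2 * expR 1 + 2 * K1 + 64 * K2); split; first by lra.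
set C := 10 + _ + _ + _.
move=> h hh L E lambda L0 EL c0 l0 phi phiS; have [gh _ h1] := hh.
have [B phiB] := spectral_space_bounded phiS.
have [z0 Ez0] : E !=set0.
  apply/set0P; apply: contraTneq c0 => ->.
  by rewrite hausdorff_content_set0// ltxx.
have L0in : `[0, L]%classic 0 by rewrite /= in_itv/= lexx ltW.
set M := sup_abs E phi.
have M0 : 0 <= M := le_trans (normr_ge0 _) (le_sup_abs phiB Ez0).
have p0 := pi_gt0 R; have p2 := pi_ge2 R.
set r := Num.sqrt lambda.
have r0 : 0 < r by rewrite sqrtr_gt0.
have rE : r ^+ 2 = lambda by rewrite sqr_sqrtr// ltW.
pose N := Num.truncn (L * r / pi).
have N_le k : dirichlet_eigenvalue L k <= lambda -> (k <= N)%N.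
  rewrite /dirichlet_eigenvalue -rE ler_sqr ?nnegrE ?(ltW r0)//; last first.
    by rewrite divr_ge0 ?mulr_ge0 ?(ltW L0) ?(ltW p0).
  rewrite ler_pdivrMr// [r * L]mulrC -ler_pdivlMr// => kN.
  by rewrite /N truncn_ge_nat// divr_ge0 ?mulr_ge0// ltW.
have [N0|N0] := posnP N.
  have [q sq phiE] := spectral_space_poly N_le phiS.
  apply: (@le_trans _ _ 0); last by rewrite !mulr_ge0 ?expR_ge0.
  apply: (sup_abs_le L0in) => y _; rewrite phiE.
  move: sq; rewrite N0 leqn0 size_poly_eq0 => /eqP ->.
  by rewrite horner0 mulr0 normr0.
set n := (2 * N).+1.
(* Since [N >= 1] and [pi >= 2], [2N + 1 <= 4N <= 2 N pi <= 2 L r]. *)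
have n_le : n%:R <= 2 * L * r.
  have NL : N%:R * pi <= L * r.
    by rewrite -ler_pdivlMr// truncn_le// divr_ge0 ?mulr_ge0// ltW.
  have N1 : 1 <= N%:R :> R by rewrite ler1n.
  have : N%:R * 2 <= N%:R * pi :> R by rewrite ler_wpM2l.
  by rewrite /n -[(2 * N).+1%:R]natr1 natrM; lra.
set c := fine (hausdorff_content h E).
have c1E := hausdorff_content_le1 gh h1 L0 EL.
have cE : hausdorff_content h E = c%:E.
  by rewrite /c fineK// ge0_fin_numE ?(ltW c0)// (le_lt_trans c1E) ?ltry.
have c01 : 0 < c by rewrite -lte_fin -cE.
have c1 : c <= 1 by rewrite -lee_fin -cE.
set l := ln (lambda + expR 1).
have l1 : 1 <= l by rewrite -[1]expRK ler_ln ?posrE ?addr_gt0// lerDr ltW.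
have u0 : 0 < l / 4 by lra.
have [x [xinj xE xD]] := nodes_product_le (n := n) halpha u0 hh L0 EL c0 isT.
set D := expR _ in xD.
set W := l `^ (- b).
have W0 : 0 <= W by rewrite powR_ge0.
have uW : (l / 4) `^ (- (2 * alpha)) <= K2 * W.
  have l0' : 0 < l by lra.
  rewrite powRM ?invr_ge0 ?(ltW l0')// mulrC.
  have -> : 4^-1 `^ (- (2 * alpha)) = K2 :> R.
    by rewrite -[4^-1]powR_inv1// -powRrM; congr (_ `^ _); lra.
  rewrite ler_wpM2l// ler_powR// lerN2 /b; lra.
(* The factor [n] from the number of nodes is absorbed in [expR n], which raises [4 * L + 3] to
   [4 * L + 4] in the exponent. *)
have interp z : `[0, L]%classic z -> `|phi z| <= expR n%:R * D * M.
  move=> z01; have xM i : `|phi (x i)| <= M by exact: le_sup_abs phiB (xE i).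
  have xL i : 0 <= x i <= L by have := EL _ (xE i); rewrite /= in_itv.
  have := spectral_interpolation L0 N0 N_le phiS xinj xL xM xD.
  move: z01; rewrite /= in_itv/= => z01 /(_ z z01) phiz.
  rewrite -ler_sqr ?nnegrE ?mulr_ge0 ?expR_ge0// real_normK ?num_real//.
  apply: (le_trans phiz); rewrite -mulrA [leRHS]exprMn ler_wpM2r ?sqr_ge0//.
  have n1 : 1 <= n%:R :> R by rewrite ler1n.
  have : n%:R <= expR n%:R :> R by have := expR_ge1Dx (n%:R : R); lra.
  move=> en; apply: (le_trans en); rewrite expr2 ler_peMl ?expR_ge0//; lra.
apply: (sup_abs_le L0in) => z /interp /le_trans; apply.
rewrite -!expRD ler_wpM2r// ler_expR.
have L12 : L + 1 <= (L + 1) ^+ 2 by rewrite expr2 ler_peMl; lra.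
have cinv : 1 <= c ^- 2 by rewrite invf_ge1 ?exprn_gt0// exprn_ile1// ltW.
have sq := sqrt_expR_le b0 l0.
rewrite -/r -/l -/W -/K1 in sq.
have lW0 : 0 <= lambda * W by rewrite mulr_ge0// ltW.
have nu : n%:R * expR (l / 4) <=
    2 * (L + 1) ^+ 2 * (expR 1 * r + K1 * (lambda * W / c ^+ 2)).
  apply: (@le_trans _ _ (2 * L * r * expR (l / 4))).
    by rewrite ler_wpM2r// expR_ge0.
  rewrite -[leLHS]mulrA; apply: ler_pM.
  - by rewrite mulr_ge0// ltW.
  - by rewrite mulr_ge0 ?expR_ge0// ltW.
  - by lra.
  apply: (le_trans sq); rewrite lerD2l ler_wpM2l//.
  by rewrite ler_peMr.
have n2 : 16 * n%:R ^+ 2 * (l / 4) `^ (- (2 * alpha)) / c ^+ 2 <=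
    64 * K2 * (L + 1) ^+ 2 * (lambda * W / c ^+ 2).
  have -> : 64 * K2 * (L + 1) ^+ 2 * (lambda * W / c ^+ 2)
      = 16 * (2 * (L + 1) * r) ^+ 2 * (K2 * W) / c ^+ 2.
    by rewrite -rE; field; rewrite gt_eqF.
  rewrite ler_pM2r ?invr_gt0 ?exprn_gt0//.
  apply: ler_pM; rewrite ?powR_ge0 ?mulr_ge0 ?sqr_ge0//.
  rewrite ler_pM2l// ler_sqr ?nnegrE ?mulr_ge0 ?(ltW r0)//; last by lra.
  by apply: (le_trans n_le); rewrite ler_wpM2r ?(ltW r0)//; lra.
have n1 : n%:R * (4 * L + 4) <= 10 * (L + 1) ^+ 2 * r.
  apply: (@le_trans _ _ (2 * L * r * (4 * L + 4))).
    by rewrite ler_wpM2r//; lra.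
  have -> : 2 * L * r * (4 * L + 4) = (8 * L * (L + 1)) * r by ring.
  by rewrite ler_wpM2r ?(ltW r0)// expr2; nra.
set Q := (L + 1) ^+ 2 in L12 nu n2 n1 *.
set Y := lambda * W / c ^+ 2 in nu n2 *.
have -> : C * Q * lambda * W / c ^+ 2 = C * Q * Y by rewrite /Y !mulrA.
have Q0 : 0 <= Q by rewrite sqr_ge0.
have Y0 : 0 <= Y by rewrite divr_ge0 ?sqr_ge0.
(* The full [C] multiplies both [Q * r] and [Q * Y]; [z1] and [z2] are the surpluses over what the
   three bounds require. *)
have z1 : 0 <= (2 * K1 + 64 * K2) * (Q * r).
  by apply: mulr_ge0; [lra|exact: mulr_ge0 Q0 (ltW r0)].
have z2 : 0 <= (10 + 2 * expR 1) * (Q * Y).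
  by apply: mulr_ge0; [lra|exact: mulr_ge0].
by rewrite /C; lra.
Qed.
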